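(* For every signed graph $[G,\Sigma]$ and every 2-edge-colored graph $(G,C)\in[G,\Sigma]$, $$\chi_2(G,C)\le \psi_2(G,C)\le \psi_{\max}[G,\Sigma].$$
   Context: All graphs are finite, undirected and simple (no loops, no multiple edges). 2-edge-colored graphs: a 2-edge-colored graph $(G,C)$ is a graph $G$ with a set $C\subseteq E(G)$ of negative edges (the signature); the edges of $E(G)\setminus C$ are positive. Re-signing at a vertex $v$ means inverting the sign of all edges incident with $v$. Two 2-edge-colored graphs $(G,C)$ and $(G,D)$ are equivalent if one is obtained from the other by a series of re-signings. A signed graph $[G,\Sigma]$ (with $\Sigma\subseteq E(G)$) is the equivalence class of the 2-edge-colored graph $(G,\Sigma)$; its elements are called its representatives, and $(G,C)\in[G,\Sigma]$ means that $(G,C)$ is a representative of $[G,\Sigma]$. Colorings: a $k$-coloring of $(G,C)$ is a map $\alpha:V(G)\to\{1,\dots,k\}$ such that $\alpha(u)\ne\alpha(v)$ for every $uv\in E(G)$ and, for every two colors $i,j$, all edges $uv$ with $\alpha(u)=i$ and $\alpha(v)=j$ have the same sign. The chromatic number $\chi_2(G,C)$ is the smallest $k$ for which $(G,C)$ admits a $k$-coloring. Homomorphisms: a homomorphism of $(G,C)$ to $(H,D)$ is a map $\varphi:V(G)\to V(H)$ such that $uv\in E(G)$ implies $\varphi(u)\varphi(v)\in E(H)$ and, for every edge $uv\in E(G)$, $uv\in C$ if and only if $\varphi(u)\varphi(v)\in D$. It is surjective if its co-domain is the image of its domain, i.e. every vertex and every edge of $H$ is the image of a vertex, respectively an edge,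 of $G$. Write $(G,C)\rightarrow_2(H,D)$ if there is a surjective homomorphism of $(G,C)$ to $(H,D)$. Cliques and achromatic numbers: a 2-edge-colored clique is a 2-edge-colored graph which is its unique image under surjective homomorphisms, up to isomorphism; equivalently, a 2-edge-colored graph whose chromatic number $\chi_2$ equals its number of vertices. The achromatic number $\psi_2(G,C)$ is the largest order of a 2-edge-colored clique $(K,D)$ with $(G,C)\rightarrow_2(K,D)$. The signed max-achromatic number is $\psi_{\max}[G,\Sigma]=\max\{\psi_2(G,C') : (G,C')\in[G,\Sigma]\}$. *)

(* Defs.v *)
From mathcomp Require Import all_boot.
From mathcomp Require Import boolp.

(* Edges are two-element vertex sets, which rules out loops and multiple edges;
   the edge uv is [set u; v]. *)
Record sgraph := SGraph {
  vertex :> finType;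
  edges : {set {set vertex}};
  edges_card2 : forall e, e \in edges -> #|e| = 2 }.

(* A 2-edge-colored graph (G, C) is given by G : sgraph and C : {set {set G}}
   with C \subset edges G.  The definitions below only look at the sign of
   members of edges G, so they make sense, harmlessly, for any C. *)

Definition same_sign {V W : finType} (C : {set {set V}}) (D : {set {set W}})
    (e : {set V}) (f : {set W}) : Prop :=
  (e \in C) = (f \in D).

Definition resign (G : sgraph) (C : {set {set G}}) (v : G) : {set {set G}} :=
  [set e in edges G | if v \in e then e \notin C else e \in C].

(* The signed graph [G, Sigma], as the set of signatures of its
   representatives: connect is the reflexive transitive closure. *)
Definition signed_graph (G : sgraph) (Sigma : {set {set G}}) :
    {set {set {set G}}} :=
  [set C | connect [rel A B : {set {set G}} | [exists v, B == resign G A v]]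
             Sigma C].

Definition coloring (G : sgraph) (C : {set {set G}}) (k : nat)
    (alpha : G -> 'I_k) : Prop :=
  (forall u v, [set u; v] \in edges G -> alpha u <> alpha v) /\
  (forall (i j : 'I_k) (u v u' v' : G),
     [set u; v] \in edges G -> alpha u = i -> alpha v = j ->
     [set u'; v'] \in edges G -> alpha u' = i -> alpha v' = j ->
     same_sign C C [set u; v] [set u'; v']).

Definition colorable (G : sgraph) (C : {set {set G}}) (k : nat) : Prop :=
  exists alpha : G -> 'I_k, coloring G C k alpha.

Definition homomorphism (G : sgraph) (C : {set {set G}})
    (H : sgraph) (D : {set {set H}}) (phi : G -> H) : Prop :=
  forall u v, [set u; v] \in edges G ->
    [set phi u; phi v] \in edges H /\
    same_sign C D [set u; v] [set phi u; phi v].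

Definition surjective_hom (G : sgraph) (C : {set {set G}})
    (H : sgraph) (D : {set {set H}}) (phi : G -> H) : Prop :=
  [/\ homomorphism G C H D phi,
      forall x : H, exists u : G, phi u = x
    & forall f, f \in edges H -> exists2 e, e \in edges G & phi @: e = f].

Definition has_image (G : sgraph) (C : {set {set G}})
    (H : sgraph) (D : {set {set H}}) : Prop :=
  exists phi : G -> H, surjective_hom G C H D phi.

Definition isomorphic (G : sgraph) (C : {set {set G}})
    (H : sgraph) (D : {set {set H}}) : Prop :=
  exists phi : G -> H,
    [/\ bijective phi,
        forall u v, ([set phi u; phi v] \in edges H) = ([set u; v] \in edges G)
      & forall u v, [set u; v] \in edges G ->
          same_sign C D [set u; v] [set phi u; phi v]].

Definition clique (K : sgraph) (D : {set {set K}}) : Prop :=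
  forall (H : sgraph) (D' : {set {set H}}), D' \subset edges H ->
    has_image K D H D' -> isomorphic K D H D'.

Definition has_clique_image (G : sgraph) (C : {set {set G}}) (k : nat) : Prop :=
  exists (K : sgraph) (D : {set {set K}}),
    [/\ D \subset edges K, clique K D, has_image G C K D & #|K| = k].

Lemma edge_neq (G : sgraph) (u v : G) : [set u; v] \in edges G -> u <> v.
Proof. by move=> /edges_card2 + uv; rewrite uv setUid cards1. Qed.

Lemma ex_colorable (G : sgraph) (C : {set {set G}}) :
  exists k, `[< colorable G C k >].
Proof.
exists #|G|; apply/asboolP; exists (@enum_rank G); split.
  by move=> u v /edge_neq uv /enum_rank_inj.
by move=> i j u v u' v' _ <- <- _ /enum_rank_inj-> /enum_rank_inj->.
Qed.

Lemma has_image_trans (G : sgraph) (C : {set {set G}})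
    (H : sgraph) (D : {set {set H}}) (K : sgraph) (F : {set {set K}}) :
  has_image G C H D -> has_image H D K F -> has_image G C K F.
Proof.
move=> [f [fh fv fe]] [g [gh gv ge]]; exists (g \o f); split.
- move=> u v /fh[/gh[? gs] fs]; split=> //.
  by rewrite /same_sign fs gs.
- by move=> x; have [y <-] := gv x; have [z <-] := fv y; exists z.
- move=> e /ge[e1 /fe[e2 he2 <-] <-]; exists e2 => //.
  by rewrite imset_comp.
Qed.

Lemma has_image_card (G : sgraph) (C : {set {set G}})
    (H : sgraph) (D : {set {set H}}) : has_image G C H D -> #|H| <= #|G|.
Proof.
move=> [f [_ fv _]]; rewrite cardE -(size_codom f).
apply: (uniq_leq_size (enum_uniq H)) => x _.
by have [u <-] := fv x; exact: codom_f.
Qed.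

Lemma has_image_iso (G : sgraph) (C : {set {set G}})
    (H : sgraph) (D : {set {set H}}) :
  has_image G C H D -> #|G| <= #|H| -> isomorphic G C H D.
Proof.
move=> GH leGH; have leHG := has_image_card _ _ _ _ GH.
have [f [fh fv fe]] := GH.
have finj : injective f.
  apply/injectiveP; rewrite /dinjectiveb /injectiveb.
  apply: (leq_size_uniq (enum_uniq H)); last by rewrite size_map -!cardE.
  by move=> x _; have [u <-] := fv x; exact: codom_f.
exists f; split.
- exact: inj_card_bij.
- move=> u v; apply/idP/idP => [/fe[e he E]|/fh[]//].
  suff -> : [set u; v] = e by [].
  by apply: (imset_inj finj); rewrite E imsetU1 imset_set1.
- by move=> u v /fh[].
Qed.

Lemma ex_clique_image (G : sgraph) (C : {set {set G}}) :
  exists k, `[< has_clique_image G C k >].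
Proof.
pose image_order n := exists (H : sgraph) (D : {set {set H}}),
  [/\ D \subset edges H, has_image G C H D & #|H| = n].
have ex_im : exists n, `[< image_order n >].
  exists #|G|; apply/asboolP; exists G, (C :&: edges G).
  split=> //; first exact: subsetIr.
  exists id; split.
  - by move=> u v uv; split=> //; rewrite /same_sign inE uv andbT.
  - by move=> x; exists x.
  - by move=> e he; exists e; rewrite ?imset_id.
case: (ex_minnP ex_im) => n /asboolP[H [D [sD GH cH]]] nmin.
exists n; apply/asboolP; exists H, D; split=> // H' D' sD' HH'.
apply: has_image_iso => //; rewrite cH; apply: nmin; apply/asboolP.
by exists H', D'; split=> //; exact: has_image_trans GH HH'.
Qed.

Lemma clique_image_bound (G : sgraph) (C : {set {set G}}) (k : nat) :
  `[< has_clique_image G C k >] -> k <= #|G|.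
Proof. by move=> /asboolP[K [D [_ _ /has_image_card + <-]]]. Qed.

Definition chi2 (G : sgraph) (C : {set {set G}}) : nat :=
  ex_minn (ex_colorable G C).

Definition psi2 (G : sgraph) (C : {set {set G}}) : nat :=
  ex_maxn (ex_clique_image G C) (clique_image_bound G C).

(* The maximum is over a nonempty set, as it contains Sigma. *)
Definition psi_max (G : sgraph) (Sigma : {set {set G}}) : nat :=
  \max_(C in signed_graph G Sigma) psi2 G C.

(* Main.v *)
Require Import Defs.
From mathcomp Require Import all_boot.
From mathcomp Require Import boolp.

(** The lower bound holds because a homomorphism of [(G, C)] to [(H, D)] is
    itself a coloring of [(G, C)], the colors being the vertices of [H]: edges
    of [H] join distinct vertices, and the sign of an edge of [G] is read off
    the edge of [H] below it, hence depends only on the two colors at its ends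
    ([homomorphism_colorable]).  So [chi2 G C] is at most the order of every
    homomorphic image, and [psi2 G C] is the order of one of them, a largest
    clique.  The upper bound holds because [psi_max] is a maximum over the
    representatives, of which [(G, C)] is one. *)

(** The colors must be ordinals, so the vertices of [H] are numbered by
    [enum_rank]; injectivity of this numbering lets equal colors be read as
    equal images. *)
Lemma homomorphism_colorable (G : sgraph) (C : {set {set G}})
    (H : sgraph) (D : {set {set H}}) (phi : G -> H) :
  homomorphism G C H D phi -> colorable G C #|H|.
Proof.
move=> hom_phi; exists (fun u => enum_rank (phi u)); split.
  by move=> u v /hom_phi[/edge_neq phi_uv _] /enum_rank_inj.
move=> i j u v u' v' /hom_phi[_ sgn_uv] <- <-.
move=> /hom_phi[_ sgn_uv'] /enum_rank_inj eq_u /enum_rank_inj eq_v.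
by rewrite /same_sign sgn_uv sgn_uv' eq_u eq_v.
Qed.

Lemma chi2_le (G : sgraph) (C : {set {set G}}) (k : nat) :
  colorable G C k -> chi2 G C <= k.
Proof.
by move=> col_k; rewrite /chi2; case: ex_minnP => n _; apply; apply/asboolP.
Qed.

Lemma chi2_le_clique_image (G : sgraph) (C : {set {set G}}) (k : nat) :
  has_clique_image G C k -> chi2 G C <= k.
Proof.
case=> K [D [_ _ [phi [hom_phi _ _]] <-]].
exact/chi2_le/(homomorphism_colorable G C K D phi).
Qed.

Lemma psi2_clique_image (G : sgraph) (C : {set {set G}}) :
  has_clique_image G C (psi2 G C).
Proof. by rewrite /psi2; case: ex_maxnP => n /asboolP. Qed.

Theorem theorem2 (G : sgraph) (Sigma : {set {set G}})
    (hSigma : Sigma \subset edges G)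
    (C : {set {set G}}) (hC : C \in signed_graph G Sigma) :
  chi2 G C <= psi2 G C <= psi_max G Sigma.
Proof.
apply/andP; split; first exact/chi2_le_clique_image/psi2_clique_image.
exact: (leq_bigmax_cond (F := psi2 G)).
Qed.
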